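(* Let $(\mathfrak g,[-,-])$ be a (pure even) finite-dimensional real Lie algebra of dimension $n$. Then, as super vector spaces, $$HC^0_\lambda(\Pi\mathfrak g,\mathrm d_{CE})\cong\mathcal Z_\bullet(\mathfrak g)=\bigoplus_{k=0}^n\mathcal Z_k(\mathfrak g),$$ where $\mathcal Z_k(\mathfrak g)$ are the Lie algebra cycle groups and elements of $\mathcal Z_k(\mathfrak g)$ are assigned Grassmann parity $k$ mod $2$.
   Context: $\Pi\mathfrak g$ is the purely odd linear supermanifold obtained from $\mathfrak g$ by parity shift; $C^\infty(\Pi\mathfrak g)\cong\Lambda^\bullet\mathfrak g^*$, with Grassmann parity $\widetilde\alpha=k$ mod 2 for $\alpha\in\Lambda^k\mathfrak g^*$. With a basis $e_a$ of $\mathfrak g$, $[e_a,e_b]=Q_{ab}^ce_c$, and dual odd coordinates $\eta^a$, the Chevalley--Eilenberg differential is $\mathrm d_{CE}=\frac12\eta^b\eta^aQ_{ab}^c\frac{\partial}{\partial\eta^c}$, an odd derivation with $\mathrm d_{CE}^2=0$. Derived product: $\alpha\star\beta:=(-1)^{\widetilde\alpha}\,\mathrm d_{CE}(\alpha)\,\beta$ (for homogeneous $\alpha$, extended bilinearly). Shifted parity: $\overline\alpha:=\widetilde\alpha+1$. Derived cyclic $0$-cochains $C^0_\lambda(\Pi\mathfrak g,\mathrm d_{CE})$ are all $\mathbb R$-linear functionals $\tau:\Lambda^\bullet\mathfrak g^*\to\mathbb R$ (even and odd, graded by standard Grassmann parity), and $(b\tau)(\alpha,\beta)=\tau(\alpha\star\beta)-(-1)^{\overline\alpha\,\overline\beta}\tau(\beta\star\alpha)$.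 The zeroth derived cyclic cohomology is $HC^0_\lambda(\Pi\mathfrak g,\mathrm d_{CE})=\{\tau\in C^0_\lambda:b\tau=0\}$. The Chevalley--Eilenberg boundary operator $\partial_{CE}:\Lambda^k\mathfrak g\to\Lambda^{k-1}\mathfrak g$ is defined by $\langle\tau,\mathrm d_{CE}\alpha\rangle=\langle\partial_{CE}\tau,\alpha\rangle$ for the canonical pairing between $\Lambda^\bullet\mathfrak g$ and $\Lambda^\bullet\mathfrak g^*$, and $\mathcal Z_k(\mathfrak g)=\ker(\partial_{CE}:\Lambda^k\mathfrak g\to\Lambda^{k-1}\mathfrak g)$. *)

(* Defs.v *)
From HB Require Import structures.
From mathcomp Require Import all_boot all_order all_algebra.

Set Implicit Arguments.
Unset Strict Implicit.
Unset Printing Implicit Defensive.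

Import GRing.Theory.
Local Open Scope ring_scope.

(* Finite-dimensional super vector spaces; [false] is the even part, [true]  *)
(* the odd part.                                                             *)
Record superVect (K : fieldType) := SuperVect {
  sv_space :> vectType K;
  sv_part : bool -> {vspace sv_space};
  sv_full : (sv_part false + sv_part true)%VS = fullv;
  sv_cap0 : (sv_part false :&: sv_part true)%VS = 0%VS }.

Definition sv_isomorphic (K : fieldType) (V W : superVect K) : Prop :=
  exists f : 'Hom(V, W),
    bijective f /\ forall p : bool, (f @: sv_part V p)%VS = sv_part W p.

Section SubSuper.
Variables (K : fieldType) (V : vectType K) (U : {vspace V}).
Variable W : bool -> {vspace V}.
Hypothesis WU : (W false + W true)%VS = U.
Hypothesis W0 : (W false :&: W true)%VS = 0%VS.

Definition sub_part (p : bool) : {vspace subvs_of U} :=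
  (linfun (vsval : subvs_of U -> V) @^-1: W p)%VS.

Lemma mem_sub_part p (u : subvs_of U) : (u \in sub_part p) = (vsval u \in W p).
Proof. by rewrite -memv_preim lfunE. Qed.

Lemma sub_part_full : (sub_part false + sub_part true)%VS = fullv.
Proof.
apply/vspaceP => u; rewrite memvf.
have /memv_addP[u0 W0u [u1 W1u eu]] : vsval u \in (W false + W true)%VS.
  by rewrite WU subvsP.
have U0 : u0 \in U by rewrite -WU (subvP (addvSl _ _)).
have U1 : u1 \in U by rewrite -WU (subvP (addvSr _ _)).
have -> : u = vsproj U u0 + vsproj U u1.
  by apply: val_inj; rewrite linearD /= !vsprojK.
by rewrite memv_add // mem_sub_part vsprojK.
Qed.

Lemma sub_part_cap0 : (sub_part false :&: sub_part true)%VS = 0%VS.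
Proof.
apply/vspaceP => u; rewrite memv_cap !mem_sub_part -memv_cap W0 !memv0.
by rewrite -(inj_eq val_inj) linear0.
Qed.

Definition sub_super : superVect K := SuperVect sub_part_full sub_part_cap0.

End SubSuper.

(* The Grassmann algebra on generators indexed by 'I_n, a vector being the   *)
(* family of its coefficients on the monomials g_A = g_(a_1) ... g_(a_k),    *)
(* A = {a_1 < ... < a_k}.                                                    *)
Record grassmann (K : fieldType) (n : nat) := Grassmann {
  gcoef :> {ffun {set 'I_n} -> K} }.
Arguments gcoef {K n} _ : simpl never.

Section Grassmann.
Variables (K : fieldType) (n : nat).
Local Notation G := (grassmann K n).
Implicit Types (A B C : {set 'I_n}) (x y z : G).

HB.instance Definition _ := [isNew for @gcoef K n].
HB.instance Definition _ := [Choice of G by <:].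

Lemma grassmannP x y : (forall A, x A = y A) -> x = y.
Proof. by move=> xy; apply/val_inj/ffunP. Qed.

Definition gzero : G := Grassmann [ffun=> 0].
Definition gopp x : G := Grassmann [ffun A => - x A].
Definition gadd x y : G := Grassmann [ffun A => x A + y A].
Definition gscale (c : K) x : G := Grassmann [ffun A => c * x A].

Lemma gaddA : associative gadd.
Proof. by move=> x y z; apply: grassmannP => A; rewrite !ffunE addrA. Qed.
Lemma gaddC : commutative gadd.
Proof. by move=> x y; apply: grassmannP => A; rewrite !ffunE addrC. Qed.
Lemma gadd0 : left_id gzero gadd.
Proof. by move=> x; apply: grassmannP => A; rewrite !ffunE add0r. Qed.
Lemma gaddN : left_inverse gzero gopp gadd.
Proof. by move=> x; apply: grassmannP => A; rewrite !ffunE addNr. Qed.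
HB.instance Definition _ := GRing.isZmodule.Build G gaddA gaddC gadd0 gaddN.

Lemma gscaleA (a b : K) x : gscale a (gscale b x) = gscale (a * b) x.
Proof. by apply: grassmannP => A; rewrite !ffunE mulrA. Qed.
Lemma gscale1 : left_id 1 gscale.
Proof. by move=> x; apply: grassmannP => A; rewrite !ffunE mul1r. Qed.
Lemma gscaleDr : right_distributive gscale +%R.
Proof. by move=> c x y; apply: grassmannP => A; rewrite !ffunE mulrDr. Qed.
Lemma gscaleDl x : {morph gscale^~ x : a b / a + b}.
Proof. by move=> a b; apply: grassmannP => A; rewrite !ffunE mulrDl. Qed.
HB.instance Definition _ :=
  GRing.Zmodule_isLmodule.Build K G gscaleA gscale1 gscaleDr gscaleDl.

Lemma gcoef0 A : (0 : G) A = 0. Proof. by rewrite ffunE. Qed.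
Lemma gcoefD x y A : (x + y) A = x A + y A. Proof. by rewrite ffunE. Qed.
Lemma gcoefN x A : (- x) A = - x A. Proof. by rewrite ffunE. Qed.
Lemma gcoefZ (c : K) x A : (c *: x) A = c * x A. Proof. by rewrite ffunE. Qed.
Lemma gcoef_sum (I : Type) (r : seq I) (P : pred I) (F : I -> G) A :
  (\sum_(i <- r | P i) F i) A = \sum_(i <- r | P i) F i A.
Proof.
apply: (big_morph (fun x : G => x A)) => [x y|]; [exact: gcoefD|exact: gcoef0].
Qed.

Lemma grassmann_vect_axiom : Vector.axiom #|{set 'I_n}| G.
Proof.
exists (fun x => \row_i x (enum_val i)).
  by move=> c x y; apply/rowP => i; rewrite !mxE gcoefD gcoefZ.
exists (fun r : 'rV_#|{set 'I_n}| =>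
  Grassmann [ffun A => r 0 (enum_rank A)]) => [x|r].
  by apply: grassmannP => A; rewrite ffunE mxE enum_rankK.
by apply/rowP => i; rewrite mxE ffunE enum_valK.
Qed.
HB.instance Definition _ := Lmodule_hasFinDim.Build K G grassmann_vect_axiom.

Definition gmono A : G := Grassmann [ffun B => (A == B)%:R].

Lemma gmonoE A B : gmono A B = (A == B)%:R. Proof. by rewrite ffunE. Qed.

(* The transpositions needed to sort the concatenation of A and B. *)
Definition ginv A B : nat := (\sum_(a in A) \sum_(b in B) (b < a))%N.

Definition gmono_mul A B : G :=
  if [disjoint A & B] then (-1) ^+ ginv A B *: gmono (A :|: B) else 0.

Definition gmul x y : G := \sum_A \sum_B (x A * y B) *: gmono_mul A B.

Lemma gsum_coef (P : pred {set 'I_n}) (c : {set 'I_n} -> K) B :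
  (\sum_(A | P A) c A *: gmono A) B = if P B then c B else 0.
Proof.
rewrite gcoef_sum.
rewrite (eq_bigr (fun A => if A == B then c A else 0)) => [|A _]; last first.
  by rewrite gcoefZ gmonoE; case: (A == B); rewrite ?mulr1 ?mulr0.
case: ifP => PB; last first.
  by rewrite big1 // => A PA; case: (A =P B) => // AB; rewrite -AB PA in PB.
by rewrite (bigD1 B) //= eqxx big1 ?addr0 // => A /andP[_ /negPf->].
Qed.

Lemma gexpand x : x = \sum_A x A *: gmono A.
Proof. by apply: grassmannP => B; rewrite gsum_coef. Qed.

Lemma gmul_linearl y : linear (gmul^~ y).
Proof.
move=> c u v; rewrite /gmul scaler_sumr -big_split /=; apply: eq_bigr => A _.
rewrite scaler_sumr -big_split /=; apply: eq_bigr => B _.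
by rewrite gcoefD gcoefZ scalerA -scalerDl mulrDl mulrA.
Qed.

Lemma gmul_linearr x : linear (gmul x).
Proof.
move=> c u v; rewrite /gmul scaler_sumr -big_split /=; apply: eq_bigr => A _.
rewrite scaler_sumr -big_split /=; apply: eq_bigr => B _.
by rewrite gcoefD gcoefZ scalerA -scalerDl mulrDr mulrCA.
Qed.

Definition gmul_flip y x := gmul x y.
HB.instance Definition _ y :=
  GRing.isLinear.Build K G G *:%R (gmul_flip y) (gmul_linearl y).
HB.instance Definition _ x :=
  GRing.isLinear.Build K G G *:%R (gmul x) (gmul_linearr x).

Lemma gmulMM A B : gmul (gmono A) (gmono B) = gmono_mul A B.
Proof.
rewrite /gmul (bigD1 A) //= [X in _ + X]big1 ?addr0 => [|A' neA]; last first.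
  by rewrite big1 // => B' _; rewrite !(gcoefD, gcoefZ, gcoef0, gmonoE) eq_sym (negPf neA) mul0r scale0r.
rewrite (bigD1 B) //= big1 ?addr0 => [|B' neB].
  by rewrite !(gcoefD, gcoefZ, gcoef0, gmonoE) !eqxx mulr1 scale1r.
by rewrite !(gcoefD, gcoefZ, gcoef0, gmonoE) [B == _]eq_sym (negPf neB) mulr0 scale0r.
Qed.

Lemma gmulZl (c : K) x y : gmul (c *: x) y = c *: gmul x y.
Proof. exact: (linearZ_LR (gmul_flip y)). Qed.
Lemma gmulZr (c : K) x y : gmul x (c *: y) = c *: gmul x y.
Proof. exact: (linearZ_LR (gmul x)). Qed.
Lemma gmul0l y : gmul 0 y = 0. Proof. exact: (linear0 (gmul_flip y)). Qed.
Lemma gmul0r x : gmul x 0 = 0. Proof. exact: (linear0 (gmul x)). Qed.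
Lemma gmulDl : left_distributive gmul +%R.
Proof. by move=> x y z; exact: (linearD (gmul_flip z) x y). Qed.
Lemma gmulDr : right_distributive gmul +%R.
Proof. by move=> x y z; exact: (linearD (gmul x) y z). Qed.
Lemma gmul_suml (I : finType) (P : pred I) (F : I -> G) y :
  gmul (\sum_(i | P i) F i) y = \sum_(i | P i) gmul (F i) y.
Proof. exact: (linear_sum (gmul_flip y)). Qed.
Lemma gmul_sumr (I : finType) (P : pred I) (F : I -> G) x :
  gmul x (\sum_(i | P i) F i) = \sum_(i | P i) gmul x (F i).
Proof. exact: (linear_sum (gmul x)). Qed.

Lemma sum_disjointU (F : 'I_n -> nat) A B : [disjoint A & B] ->
  (\sum_(i in A :|: B) F i = \sum_(i in A) F i + \sum_(i in B) F i)%N.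
Proof.
move=> dAB; rewrite -bigU //; apply: eq_bigl => i; exact: in_setU.
Qed.

Lemma ginvUl A B C : [disjoint A & B] ->
  ginv (A :|: B) C = (ginv A C + ginv B C)%N.
Proof. by move=> dAB; rewrite /ginv sum_disjointU. Qed.

Lemma ginvUr A B C : [disjoint B & C] ->
  ginv A (B :|: C) = (ginv A B + ginv A C)%N.
Proof.
move=> dBC; rewrite /ginv -big_split /=; apply: eq_bigr => a _.
exact: sum_disjointU.
Qed.

Lemma gmonoMA A B C :
  gmul (gmono A) (gmono_mul B C) = gmul (gmono_mul A B) (gmono C).
Proof.
rewrite /gmono_mul; have [dBC|ndBC] := boolP [disjoint B & C].
  have [dAB|ndAB] := boolP [disjoint A & B].
    rewrite gmulZl gmulZr !gmulMM /gmono_mul !disjoints_subset.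
    rewrite subUset setCU subsetI -!disjoints_subset dAB dBC /= andbT.
    case: ifP => [dAC|]; last by rewrite !scaler0.
    by rewrite !scalerA -!exprD ginvUl ?ginvUr // setUA [in LHS]addnC addnA.
  rewrite gmul0l gmulZr gmulMM /gmono_mul disjoints_subset setCU subsetI.
  by rewrite -disjoints_subset (negPf ndAB) scaler0.
rewrite gmul0r; case: ifP => dAB; last by rewrite gmul0l.
rewrite gmulZl gmulMM /gmono_mul disjoints_subset subUset -!disjoints_subset.
by rewrite (negPf ndBC) andbF scaler0.
Qed.

Lemma gmulA : associative gmul.
Proof.
move=> x y z; rewrite (gexpand x) [LHS]gmul_suml [gmul _ y]gmul_suml.
rewrite [RHS]gmul_suml; apply: eq_bigr => A _.
rewrite !gmulZl; apply: congr1.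
rewrite (gexpand y) [gmul (\sum_B _) z]gmul_suml [LHS]gmul_sumr.
rewrite [gmul (gmono A) (\sum_B _)]gmul_sumr [RHS]gmul_suml.
apply: eq_bigr => B _; rewrite !(gmulZl, gmulZr); apply: congr1.
rewrite (gexpand z) [gmul (gmono B) _]gmul_sumr [LHS]gmul_sumr [RHS]gmul_sumr.
by apply: eq_bigr => C _; rewrite !gmulZr !gmulMM gmonoMA.
Qed.

Lemma gmul1l : left_id (gmono set0) gmul.
Proof.
move=> x; rewrite [x in LHS]gexpand gmul_sumr [RHS]gexpand; apply: eq_bigr.
move=> A _; rewrite gmulZr gmulMM /gmono_mul disjoints_subset sub0set set0U.
by rewrite /ginv big_set0 scale1r.
Qed.

Lemma gmul1r : right_id (gmono set0) gmul.
Proof.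
move=> x; rewrite [x in LHS]gexpand gmul_suml [RHS]gexpand; apply: eq_bigr.
move=> A _; rewrite gmulZl gmulMM /gmono_mul disjoints_subset setC0 subsetT.
rewrite setU0 /ginv big1 ?scale1r // => a _; exact: big_set0.
Qed.

Lemma gone_neq0 : gmono set0 != 0.
Proof.
apply/eqP => /(congr1 (fun x : G => x set0)); rewrite gcoef0 gmonoE eqxx.
by apply/eqP; rewrite oner_eq0.
Qed.

HB.instance Definition _ := GRing.Zmodule_isNzRing.Build G
  gmulA gmul1l gmul1r gmulDl gmulDr gone_neq0.
HB.instance Definition _ := GRing.Lmodule_isLalgebra.Build K G
  (fun c x y => esym (gmulZl c x y)).
HB.instance Definition _ := GRing.Lalgebra_isAlgebra.Build K G
  (fun c x y => esym (gmulZr c x y)).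

Lemma gmonoM A B : gmono A * gmono B = gmono_mul A B.
Proof. exact: gmulMM. Qed.

Definition ggen (a : 'I_n) : G := gmono [set a].

Lemma ggen_sq a : ggen a * ggen a = 0.
Proof. by rewrite gmonoM /gmono_mul disjoints_subset sub1set !inE eqxx. Qed.

Lemma ggen_anticomm a b : ggen a * ggen b = - (ggen b * ggen a).
Proof.
have [->|neab] := eqVneq a b; first by rewrite ggen_sq oppr0.
rewrite !gmonoM /gmono_mul !disjoints_subset !sub1set !inE neab eq_sym neab.
rewrite /ginv !big_set1 setUC -scaleNr.
by case: ltngtP neab => [||/val_inj->]; rewrite ?eqxx ?expr0 ?expr1 ?opprK.
Qed.

(* The left derivative with respect to the generator g_c. *)
Definition gderiv (c : 'I_n) (x : G) : G :=
  \sum_(A : {set 'I_n} | c \in A)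
     (x A * (-1) ^+ #|[set a in A | (a < c)%N]|) *: gmono (A :\ c).

Lemma gderiv_linear c : linear (gderiv c).
Proof.
move=> k u v; rewrite /gderiv scaler_sumr -big_split; apply: eq_bigr => A _ /=.
by rewrite gcoefD gcoefZ scalerA -scalerDl mulrDl mulrA.
Qed.
HB.instance Definition _ c :=
  GRing.isLinear.Build K G G *:%R (gderiv c) (gderiv_linear c).

Definition gdeg (k : nat) : {vspace G} :=
  <<[seq gmono A | A in [pred A : {set 'I_n} | #|A| == k]]>>%VS.

Definition gpar (p : bool) : {vspace G} :=
  <<[seq gmono A | A in [pred A : {set 'I_n} | odd #|A| == p]]>>%VS.

(* The component of Grassmann parity p. *)
Definition gproj (p : bool) (x : G) : G :=
  \sum_(A : {set 'I_n} | odd #|A| == p) x A *: gmono A.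

Lemma gproj_linear p : linear (gproj p).
Proof.
move=> k u v; rewrite /gproj scaler_sumr -big_split; apply: eq_bigr => A _ /=.
by rewrite gcoefD gcoefZ scalerA -scalerDl.
Qed.
HB.instance Definition _ p :=
  GRing.isLinear.Build K G G *:%R (gproj p) (gproj_linear p).

Lemma gproj_sum x : x = gproj false x + gproj true x.
Proof.
rewrite [LHS]gexpand (bigID (fun A : {set 'I_n} => odd #|A|)) addrC /=.
by congr (_ + _); apply: eq_bigl => A; case: odd.
Qed.

Lemma gsupp_span (P : pred {set 'I_n}) x :
  (x \in <<[seq gmono A | A in P]>>%VS)
    = [forall A, ~~ P A ==> (x A == 0)].
Proof.
apply/idP/forallP => [xP A|x0].
  apply/implyP => nPA; rewrite (coord_span xP) gcoef_sum big1 // => i _.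
  have iP : (i < size [seq gmono A | A in P])%N by rewrite size_image.
  rewrite gcoefZ /=; have /imageP[B PB ->] := mem_nth 0 iP.
  rewrite gmonoE; case: eqP => [eBA|_]; last exact: mulr0.
  by case/negP: nPA; rewrite -eBA.
rewrite (gexpand x); apply: memv_suml => A _.
case PA : (P A); last by have:= x0 A; rewrite PA => /eqP->; rewrite scale0r mem0v.
by apply/memvZ/memv_span/image_f.
Qed.

Lemma gdegP k x :
  reflect (forall A, #|A| != k -> x A = 0) (x \in gdeg k).
Proof.
rewrite gsupp_span; apply: (iffP forallP) => H A; last first.
  by apply/implyP => /H->.
by move=> nA; apply/eqP/(implyP (H A)).
Qed.

Lemma gparP p x :
  reflect (forall A, odd #|A| != p -> x A = 0) (x \in gpar p).
Proof.
rewrite gsupp_span; apply: (iffP forallP) => H A; last first.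
  by apply/implyP => /H->.
by move=> nA; apply/eqP/(implyP (H A)).
Qed.

Lemma gprojE p x A : gproj p x A = if odd #|A| == p then x A else 0.
Proof. exact: gsum_coef. Qed.

Lemma gproj_par p x : gproj p x \in gpar p.
Proof. by apply/gparP => A /negPf nA; rewrite gprojE nA. Qed.

Lemma gproj_id p x : x \in gpar p -> gproj p x = x.
Proof. by move/gparP=> xp; apply: grassmannP => A; rewrite gprojE; case: eqP => // /eqP/xp. Qed.

Lemma gproj_neq p q x : x \in gpar q -> p != q -> gproj p x = 0.
Proof.
move/gparP=> xq npq; apply: grassmannP => A; rewrite gprojE gcoef0; case: eqP => // Ap.
by rewrite xq // Ap.
Qed.

Lemma gpar_cap0 : (gpar false :&: gpar true)%VS = 0%VS.
Proof.
apply/vspaceP => x; rewrite memv_cap memv0; apply/andP/eqP => [[x0 x1]|->].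
  by rewrite -(gproj_id x0) (gproj_neq (p := false) x1).
by rewrite !mem0v.
Qed.

Lemma gmono_deg A : gmono A \in gdeg #|A|.
Proof.
by apply/gdegP => B nAB; rewrite gmonoE; case: (A =P B) nAB => // ->; rewrite eqxx.
Qed.

Lemma gmono_par A : gmono A \in gpar (odd #|A|).
Proof.
by apply/gparP => B nAB; rewrite gmonoE; case: (A =P B) nAB => // ->; rewrite eqxx.
Qed.

Lemma ggen_par a : ggen a \in gpar true.
Proof. by have := gmono_par [set a]; rewrite cards1. Qed.

Lemma gmul_par p q x y :
  x \in gpar p -> y \in gpar q -> x * y \in gpar (p (+) q).
Proof.
move=> /gparP xp /gparP yq; rewrite (_ : x * y = gmul x y) // /gmul.
apply: memv_suml => A _; apply: memv_suml => B _.
have [Ap|/xp->] := eqVneq (odd #|A|) p; last by rewrite mul0r scale0r mem0v.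
have [Bq|/yq->] := eqVneq (odd #|B|) q; last by rewrite mulr0 scale0r mem0v.
rewrite memvZ // /gmono_mul; case: ifP => dAB; last exact: mem0v.
have /eqP cAB : #|A :|: B| == (#|A| + #|B|)%N by rewrite (leq_card_setU A B).
by rewrite memvZ // -Ap -Bq -oddD -cAB gmono_par.
Qed.

Lemma gderiv_par c p x : x \in gpar p -> gderiv c x \in gpar (~~ p).
Proof.
move=> /gparP xp; apply: memv_suml => A cA.
have [Ap|/xp->] := eqVneq (odd #|A|) p; last by rewrite mul0r scale0r mem0v.
by rewrite memvZ // -Ap (cardsD1 c A) cA /= negbK gmono_par.
Qed.

Lemma gmul_deg k l x y :
  x \in gdeg k -> y \in gdeg l -> x * y \in gdeg (k + l).
Proof.
move=> /gdegP xk /gdegP yl; rewrite (_ : x * y = gmul x y) // /gmul.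
apply: memv_suml => A _; apply: memv_suml => B _.
have [Ak|/xk->] := eqVneq #|A| k; last by rewrite mul0r scale0r mem0v.
have [Bl|/yl->] := eqVneq #|B| l; last by rewrite mulr0 scale0r mem0v.
rewrite memvZ // /gmono_mul; case: ifP => dAB; last exact: mem0v.
have /eqP cAB : #|A :|: B| == (#|A| + #|B|)%N by rewrite (leq_card_setU A B).
by rewrite memvZ // -Ak -Bl -cAB gmono_deg.
Qed.

Lemma gderiv_deg c k x : x \in gdeg k.+1 -> gderiv c x \in gdeg k.
Proof.
move=> /gdegP xk; apply: memv_suml => A cA.
have [|/xk->] := eqVneq #|A| k.+1; last by rewrite mul0r scale0r mem0v.
by rewrite (cardsD1 c A) cA => -[<-]; rewrite memvZ // gmono_deg.
Qed.

Lemma gderiv_deg0 c x : x \in gdeg 0 -> gderiv c x = 0.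
Proof.
move=> /gdegP x0; apply: big1 => A cA; rewrite x0 ?mul0r ?scale0r //.
by rewrite cards_eq0; apply: contraTneq cA => ->; rewrite inE.
Qed.

Lemma gdeg_par k x : x \in gdeg k -> x \in gpar (odd k).
Proof.
move=> /gdegP xk; apply/gparP => A nA; apply: xk.
by apply: contraNneq nA => ->.
Qed.

(* <e_(a_1) ^ ... ^ e_(a_k), eta^(b_1) ... eta^(b_l)> is the Kronecker delta *)
(* for increasing indices.                                                   *)
Definition gpairing (t x : G) : K := \sum_A t A * x A.

Lemma gpairing_monol A x : gpairing (gmono A) x = x A.
Proof.
rewrite /gpairing (bigD1 A) //= big1 ?addr0 => [|B nBA].
  by rewrite !(gcoefD, gcoefZ, gcoef0, gmonoE) eqxx [LHS]mul1r.
by rewrite !(gcoefD, gcoefZ, gcoef0, gmonoE) eq_sym (negPf nBA) [LHS]mul0r.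
Qed.

Lemma gpairing_monor A t : gpairing t (gmono A) = t A.
Proof.
rewrite -[RHS]gpairing_monol; apply: eq_bigr => B _; exact: mulrC.
Qed.

Lemma gpairing_linearr t : linear_for *%R (gpairing t).
Proof.
move=> k u v; rewrite /gpairing big_distrr -big_split; apply: eq_bigr => A _ /=.
by rewrite gcoefD gcoefZ mulrDr mulrCA.
Qed.
HB.instance Definition _ t :=
  GRing.isLinear.Build K G K *%R (gpairing t) (gpairing_linearr t).

End Grassmann.

Record lieAlgebra (K : fieldType) := LieAlgebra {
  lie_space :> vectType K;
  lie_bracket : lie_space -> lie_space -> lie_space;
  lie_linearl : forall y, linear (lie_bracket^~ y);
  lie_linearr : forall x, linear (lie_bracket x);
  lie_alternating : forall x, lie_bracket x x = 0;
  lie_jacobi : forall x y z,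
    lie_bracket x (lie_bracket y z) + lie_bracket y (lie_bracket z x)
      + lie_bracket z (lie_bracket x y) = 0 }.

(* In a basis e of g, the Grassmann algebra [grassmann K n] plays two roles: *)
(* the algebra of the odd coordinates eta^a on Pi g dual to e, which is      *)
(* C^oo(Pi g) = Lambda g^*, and the exterior algebra Lambda g on the e_a.    *)
Section ChevalleyEilenberg.
Variables (K : fieldType) (g : lieAlgebra K) (n : nat) (e : n.-tuple g).
Local Notation forms := (grassmann K n).
Local Notation multivectors := (grassmann K n).
Implicit Types (x y : forms) (t : multivectors).

(* Q_ab^c *)
Definition structure_const (a b c : 'I_n) : K :=
  coord e c (lie_bracket e`_a e`_b).

Definition dCE x : forms :=
  2^-1 *: \sum_a \sum_b \sum_c
     structure_const a b c *: (ggen K b * ggen K a * gderiv c x).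

Lemma dCE_linear : linear dCE.
Proof.
move=> k u v; rewrite /dCE scalerA mulrC -scalerA -scalerDr; congr (_ *: _).
do 3! (rewrite scaler_sumr -big_split; apply: eq_bigr => ? _ /=).
by rewrite linearP mulrDr -scalerAr scalerDr !scalerA mulrC.
Qed.
HB.instance Definition _ :=
  GRing.isLinear.Build K forms forms *:%R dCE dCE_linear.

Lemma dCE_par p x : x \in gpar K n p -> dCE x \in gpar K n (~~ p).
Proof.
move=> xp; rewrite memvZ //; do 3! (apply: memv_suml => ? _); rewrite memvZ //.
rewrite -[~~ p]addFb gmul_par ?gderiv_par //.
exact: (gmul_par (ggen_par _ _) (ggen_par _ _)).
Qed.

Lemma dCE_deg k x : x \in gdeg K n k -> dCE x \in gdeg K n k.+1.
Proof.
move=> xk; rewrite memvZ //; do 3! (apply: memv_suml => ? _); rewrite memvZ //.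
case: k xk => [|k] xk; first by rewrite gderiv_deg0 // mulr0 mem0v.
have d1 a : ggen K a \in gdeg K n 1 by rewrite -(cards1 a) gmono_deg.
exact: (gmul_deg (gmul_deg (d1 _) (d1 _)) (gderiv_deg _ xk)).
Qed.

Definition star x y : forms := \sum_(p : bool) (-1) ^+ p *: (dCE (gproj p x) * y).

Local Notation cochain0 := ('Hom(forms, K^o)).
Implicit Types (tau : cochain0).

(* Both sums have one nonzero term when x and y are homogeneous. *)
Definition cyclic_b (tau : cochain0) x y : K^o :=
  \sum_(p : bool) \sum_(q : bool)
    (tau (star (gproj p x) (gproj q y))
     - (-1) ^+ (p.+1 * q.+1) * tau (star (gproj q y) (gproj p x))).

Lemma star_linearl y : linear (star^~ y).
Proof.
move=> k u v; rewrite /star scaler_sumr -big_split; apply: eq_bigr => p _ /=.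
by rewrite !linearP mulrDl -scalerAl scalerDr !scalerA mulrC.
Qed.
Lemma star_linearr x : linear (star x).
Proof.
move=> k u v; rewrite /star scaler_sumr -big_split; apply: eq_bigr => p _ /=.
by rewrite mulrDr -scalerAr scalerDr !scalerA mulrC.
Qed.
HB.instance Definition _ x :=
  GRing.isLinear.Build K forms forms *:%R (star x) (star_linearr x).

Lemma star0l y : star 0 y = 0.
Proof. by rewrite /star big1 // => p _; rewrite !linear0 mul0r scaler0. Qed.

Lemma starPl y k u v : star (k *: u + v) y = k *: star u y + star v y.
Proof. exact: star_linearl. Qed.

Lemma starPr x k u v : star x (k *: u + v) = k *: star x u + star x v.
Proof. exact: star_linearr. Qed.

Lemma gprojP p k (u v : forms) :
  gproj p (k *: u + v) = k *: gproj p u + gproj p v.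
Proof. exact: gproj_linear. Qed.

Lemma cochainP (tau : cochain0) k u v : tau (k *: u + v) = k * tau u + tau v.
Proof. exact: linearP. Qed.

Lemma cyclic_termP (r k a b c d : K) :
  (k * a + b) - r * (k * c + d) = k * (a - r * c) + (b - r * d).
Proof. by rewrite mulrDr opprD mulrBr addrACA mulrCA. Qed.

Lemma cyclic_b_linearr tau x : linear (cyclic_b tau x).
Proof.
move=> k u v; rewrite /cyclic_b.
do 2! (rewrite scaler_sumr -big_split; apply: eq_bigr => ? _ /=).
rewrite gprojP starPr starPl !cochainP; exact: cyclic_termP.
Qed.

Lemma cyclic_bPl tau y k u v :
  cyclic_b tau (k *: u + v) y = k *: cyclic_b tau u y + cyclic_b tau v y.
Proof.
rewrite /cyclic_b.
do 2! (rewrite scaler_sumr -big_split; apply: eq_bigr => ? _ /=).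
rewrite gprojP starPr starPl !cochainP; exact: cyclic_termP.
Qed.
HB.instance Definition _ tau x :=
  GRing.isLinear.Build K forms K^o *:%R (cyclic_b tau x) (cyclic_b_linearr tau x).

Definition cyclic_b_hom1 tau x : 'Hom(forms, K^o) := linfun (cyclic_b tau x).

Lemma cyclic_b_hom1E tau x y : cyclic_b_hom1 tau x y = cyclic_b tau x y.
Proof. exact: (lfunE (cyclic_b tau x)). Qed.

Lemma cyclic_b_linearl tau : linear (cyclic_b_hom1 tau).
Proof.
move=> k u v; apply/lfunP => y; rewrite add_lfunE scale_lfunE.
by rewrite !cyclic_b_hom1E cyclic_bPl.
Qed.
HB.instance Definition _ tau :=
  GRing.isLinear.Build K forms 'Hom(forms, K^o) *:%R
    (cyclic_b_hom1 tau) (cyclic_b_linearl tau).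

Definition coboundary (tau : cochain0) : 'Hom(forms, 'Hom(forms, K^o)) :=
  linfun (cyclic_b_hom1 tau).

Lemma coboundaryE tau x y : coboundary tau x y = cyclic_b tau x y.
Proof.
exact: etrans (congr1 (fun f : 'Hom(forms, K^o) => f y)
                 (lfunE (cyclic_b_hom1 tau) x)) (lfunE (cyclic_b tau x) y).
Qed.

Lemma coboundary_linear : linear coboundary.
Proof.
move=> k s t; apply/lfunP => x; apply/lfunP => y.
rewrite 2!add_lfunE 2!scale_lfunE !coboundaryE /cyclic_b.
do 2! (rewrite scaler_sumr -big_split; apply: eq_bigr => ? _ /=).
rewrite !add_lfunE !scale_lfunE; exact: cyclic_termP.
Qed.
HB.instance Definition _ :=
  GRing.isLinear.Build K cochain0 'Hom(forms, 'Hom(forms, K^o)) *:%R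
    coboundary coboundary_linear.

Definition HC0 : {vspace cochain0} := lker (linfun coboundary).

Lemma HC0P tau : reflect (forall x y, cyclic_b tau x y = 0) (tau \in HC0).
Proof.
rewrite memv_ker lfunE; apply: (iffP eqP) => [b0 x y | b0].
  by rewrite -coboundaryE b0 !zero_lfunE.
by apply/lfunP => x; apply/lfunP => y; rewrite coboundaryE b0 !zero_lfunE.
Qed.

(* A functional has parity p when it vanishes on forms of the other parity. *)
Definition restrict_par (p : bool) (tau : cochain0) : cochain0 :=
  (tau \o linfun (gproj p))%VF.

Lemma restrict_par_linear p : linear (restrict_par p).
Proof. by move=> k s t; rewrite /restrict_par comp_lfunDl comp_lfunZl. Qed.
HB.instance Definition _ p :=
  GRing.isLinear.Build K cochain0 cochain0 *:%R (restrict_par p)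
    (restrict_par_linear p).

Definition cochain0_par (p : bool) : {vspace cochain0} :=
  lker (linfun (restrict_par (~~ p))).

Lemma restrict_parE p tau x : restrict_par p tau x = tau (gproj p x).
Proof. by rewrite comp_lfunE lfunE. Qed.

Lemma cochain0_parP p tau :
  reflect (forall x, x \in gpar K n (~~ p) -> tau x = 0) (tau \in cochain0_par p).
Proof.
rewrite memv_ker lfunE; apply: (iffP eqP) => [t0 x xp | t0].
  by rewrite -(gproj_id xp) -restrict_parE t0 zero_lfunE.
by apply/lfunP => x; rewrite restrict_parE zero_lfunE t0 ?gproj_par.
Qed.

Lemma star_par p q x y : x \in gpar K n p -> y \in gpar K n q ->
  star x y \in gpar K n (~~ p (+) q).
Proof.
move=> xp yq; apply: memv_suml => p' _; rewrite memvZ //.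
have [->|npp] := eqVneq p' p; first by rewrite gproj_id // gmul_par ?dCE_par.
by rewrite (gproj_neq xp) // linear0 mul0r mem0v.
Qed.

Lemma cyclic_b_hom tau p q x y : x \in gpar K n p -> y \in gpar K n q ->
  cyclic_b tau x y = tau (star x y) - (-1) ^+ (p.+1 * q.+1) * tau (star y x).
Proof.
move=> xp yq; rewrite /cyclic_b (bigD1 p) //= [X in _ + X]big1 ?addr0; last first.
  move=> p' npp; rewrite big1 // => q' _; rewrite (gproj_neq xp) //.
  by rewrite linear0 star0l linear0 mulr0 subrr.
rewrite (bigD1 q) //= [X in _ + X]big1 ?addr0 => [|q' nqq].
  by rewrite !gproj_id.
by rewrite (gproj_neq yq) // linear0 star0l linear0 mulr0 subrr.
Qed.

Lemma cyclic_b_split tau x y : cyclic_b tau x y =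
  \sum_(p : bool) \sum_(q : bool) cyclic_b tau (gproj p x) (gproj q y).
Proof.
apply: eq_bigr => p _; apply: eq_bigr => q _.
by rewrite (cyclic_b_hom tau (gproj_par p x) (gproj_par q y)).
Qed.

Lemma restrict_par_HC0 p tau : tau \in HC0 -> restrict_par p tau \in HC0.
Proof.
move=> /HC0P t0; apply/HC0P => x y; rewrite cyclic_b_split.
apply: big1 => q _; apply: big1 => r _.
have xq := gproj_par q x; have yr := gproj_par r y.
rewrite (cyclic_b_hom _ xq yr) !restrict_parE.
have s1 := star_par xq yr.
have s2 : star (gproj r y) (gproj q x) \in gpar K n (~~ q (+) r).
  by rewrite addNb addbC -addNb; exact: star_par.
have [->|npqr] := eqVneq p (~~ q (+) r).
  by rewrite (gproj_id s1) (gproj_id s2) -(cyclic_b_hom tau xq yr) t0.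
by rewrite (gproj_neq s1 npqr) (gproj_neq s2 npqr) linear0 mulr0 subrr.
Qed.

Definition HC0_par (p : bool) : {vspace cochain0} := (HC0 :&: cochain0_par p)%VS.

Lemma restrict_par_par p tau : restrict_par p tau \in cochain0_par p.
Proof.
apply/cochain0_parP => x xp; rewrite restrict_parE (gproj_neq xp) ?linear0 //.
by case: p {xp}.
Qed.

Lemma HC0_full : (HC0_par false + HC0_par true)%VS = HC0.
Proof.
apply/eqP; rewrite eqEsubv subv_add !capvSl /=; apply/subvP => tau Ht.
have -> : tau = restrict_par false tau + restrict_par true tau.
  by apply/lfunP => x; rewrite add_lfunE !restrict_parE -linearD -gproj_sum.
by rewrite memv_add // memv_cap restrict_par_HC0 ?restrict_par_par.
Qed.

Lemma HC0_cap0 : (HC0_par false :&: HC0_par true)%VS = 0%VS.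
Proof.
apply/vspaceP => tau; rewrite memv0; apply/idP/eqP => [|->]; last exact: mem0v.
rewrite !memv_cap => /andP[/andP[_ /cochain0_parP t0] /andP[_ /cochain0_parP t1]].
apply/lfunP => x; rewrite zero_lfunE (gproj_sum x) linearD /=.
by rewrite t1 ?gproj_par // t0 ?gproj_par // addr0.
Qed.

Definition HC0_super : superVect K := sub_super HC0_full HC0_cap0.

Definition boundaryCE t : multivectors :=
  \sum_(A : {set 'I_n}) gpairing t (dCE (gmono K A)) *: gmono K A.

Lemma boundaryCE_coef t A : boundaryCE t A = gpairing t (dCE (gmono K A)).
Proof. exact: (gsum_coef xpredT). Qed.

Lemma boundaryCE_adjoint t x : gpairing t (dCE x) = gpairing (boundaryCE t) x.
Proof.
have dZ c y : gpairing t (dCE (c *: y)) = c * gpairing t (dCE y).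
  by rewrite (linearZ_LR dCE) linearZ.
rewrite [in LHS](gexpand x) (linear_sum dCE) linear_sum.
by apply: eq_bigr => A _; rewrite /= dZ boundaryCE_coef mulrC.
Qed.

Lemma boundaryCE_unique t s :
  (forall x, gpairing t (dCE x) = gpairing s x) -> s = boundaryCE t.
Proof.
by move=> ts; apply: grassmannP => A; rewrite boundaryCE_coef ts gpairing_monor.
Qed.

Lemma boundaryCE_deg k t : t \in gdeg K n k.+1 -> boundaryCE t \in gdeg K n k.
Proof.
move=> /gdegP tk; apply/gdegP => A nAk; rewrite boundaryCE_coef.
have /gdegP dA := dCE_deg (gmono_deg K A).
apply: big1 => B _; have [Bk|/tk->] := eqVneq #|B| k.+1; last exact: mul0r.
by rewrite dA ?mulr0 // Bk eqSS eq_sym.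
Qed.

Lemma boundaryCE_deg0 t : t \in gdeg K n 0 -> boundaryCE t = 0.
Proof.
move=> /gdegP t0; apply: grassmannP => A; rewrite boundaryCE_coef gcoef0.
have /gdegP dA := dCE_deg (gmono_deg K A).
apply: big1 => B _; have [B0|/t0->] := eqVneq #|B| 0%N; last exact: mul0r.
by rewrite dA ?mulr0 // B0.
Qed.

Lemma boundaryCE_linear : linear boundaryCE.
Proof.
move=> k s t; apply: grassmannP => A; rewrite gcoefD gcoefZ !boundaryCE_coef.
rewrite /gpairing big_distrr -big_split; apply: eq_bigr => B _ /=.
by rewrite gcoefD gcoefZ mulrDl mulrA.
Qed.
HB.instance Definition _ :=
  GRing.isLinear.Build K multivectors multivectors *:%R boundaryCE
    boundaryCE_linear.

Definition cycles (k : nat) : {vspace multivectors} :=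
  (gdeg K n k :&: lker (linfun boundaryCE))%VS.

Lemma cyclesP k t :
  reflect (t \in gdeg K n k /\ boundaryCE t = 0) (t \in cycles k).
Proof.
by rewrite memv_cap memv_ker lfunE; apply: (iffP andP) => -[? /eqP].
Qed.

Definition all_cycles : {vspace multivectors} := (\sum_(k < n.+1) cycles k)%VS.

Lemma cycles_direct : directv (\sum_(k < n.+1) cycles k)%VS.
Proof.
apply/directv_sum_independent => u uZ u0 k _; apply: grassmannP => A.
have [Ak|nAk] := eqVneq #|A| k; last first.
  by have /cyclesP[/gdegP->] := uZ k isT; rewrite ?gcoef0.
have := congr1 (fun t : multivectors => t A) u0; rewrite gcoef_sum gcoef0 (bigD1 k) //= big1 ?addr0 //.
move=> j njk; have /cyclesP[/gdegP-> //] := uZ j isT.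
by rewrite Ak eq_sym.
Qed.

Definition cycles_par (p : bool) : {vspace multivectors} :=
  (\sum_(k < n.+1 | odd k == p) cycles k)%VS.

Lemma all_cycles_full : (cycles_par false + cycles_par true)%VS = all_cycles.
Proof.
rewrite /all_cycles (bigID (fun k : 'I_n.+1 => odd k)) addvC /=.
by congr (_ + _)%VS; apply: eq_bigl => k; case: odd.
Qed.

Lemma all_cycles_cap0 : (cycles_par false :&: cycles_par true)%VS = 0%VS.
Proof.
have sub p : (cycles_par p <= gpar K n p)%VS.
  apply/subv_sumP => k /eqP<-; apply/subvP => t /cyclesP[tk _].
  exact: gdeg_par.
by apply/eqP; rewrite -subv0 -(gpar_cap0 K n) capvS.
Qed.

Definition cycles_super : superVect K := sub_super all_cycles_full all_cycles_cap0.

End ChevalleyEilenberg.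

(* Main.v *)
(* For x of parity p, graded commutativity and the Leibniz rule give         *)
(*   (b tau)(x, y) = (-1)^p tau (d_CE (x y)),                                *)
(* so tau is a cocycle iff tau vanishes on the image of d_CE, i.e. iff the   *)
(* multivector representing tau under the canonical pairing is killed by the *)
(* adjoint of d_CE.  Since d_CE is homogeneous of degree 1, this kernel is   *)
(* the direct sum of its homogeneous pieces, the cycle groups.               *)
Require Import Defs.
From HB Require Import structures.
From mathcomp Require Import all_boot all_order all_algebra.
From mathcomp Require Import reals.

Set Implicit Arguments.
Unset Strict Implicit.
Unset Printing Implicit Defensive.

Import GRing.Theory.
Local Open Scope ring_scope.

(** Write d for [dCE]. The cyclic sign is exactly what merges the two star products in the
    coboundary into d(xy), up to an overall sign ([cyclic_b_dCE]); this rests on graded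
    commutativity ([gmul_comm]) and on d being an odd derivation ([dCEM]). Taking y = 1 shows that
    cocycles are the functionals vanishing on the image of d ([HC0_dCEP]). The pairing identifies
    functionals on forms with multivectors ([cochain_mv]), and vanishing on the image of d becomes
    vanishing of the boundary ([HC0_cycleE]). Since the boundary lowers degree by one, the
    homogeneous components of a cycle are cycles, so its kernel in each parity is a sum of cycle
    groups ([cycles_parP]). *)

Section GrassmannDerivations.
Variables (K : fieldType) (n : nat).
Local Notation G := (grassmann K n).
Implicit Types (A B : {set 'I_n}) (x y : G).

(** * Graded commutativity of the Grassmann algebra *)

Lemma gmono_ind (P : G -> Prop) :
    P 0 -> (forall k x y, P x -> P y -> P (k *: x + y)) ->
    (forall A, P (gmono K A)) -> forall x, P x.
Proof.
move=> P0 PP PM x; rewrite (gexpand x); elim/big_rec: _ => // A y _; exact: PP.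
Qed.

Lemma gpar_ind p (P : G -> Prop) :
    P 0 -> (forall k x y, P x -> P y -> P (k *: x + y)) ->
    (forall A, odd #|A| = p -> P (gmono K A)) ->
  forall x, x \in gpar K n p -> P x.
Proof.
move=> P0 PP PM x /gproj_id <-.
by rewrite /gproj; elim/big_rec: _ => // A y /eqP/PM PA; apply: PP.
Qed.

(** Each pair of indices from A and B is distinct, hence inverted in exactly one of the two
    orders. *)
Lemma ginv_sym A B : [disjoint A & B] -> (ginv A B + ginv B A = #|A| * #|B|)%N.
Proof.
move=> dAB; rewrite /ginv [X in (_ + X)%N]exchange_big -big_split /=.
rewrite -sum_nat_const; apply: eq_bigr => a aA.
rewrite -big_split -sum1_card /=; apply: eq_bigr => b bB.
have: (a != b :> nat).
  by apply: contraTneq bB => /val_inj <-; rewrite (disjointFr dAB aA).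
by case: ltngtP.
Qed.

Lemma gmono_comm A B :
  gmono K A * gmono K B = (-1) ^+ (#|A| * #|B|) *: (gmono K B * gmono K A).
Proof.
rewrite !gmonoM /gmono_mul [in RHS]disjoint_sym.
case: ifP => [dAB|_]; last by rewrite scaler0.
by rewrite scalerA -(ginv_sym dAB) setUC exprD -mulrA -expr2 sqrr_sign mulr1.
Qed.

Lemma gmul_comm p q x y : x \in gpar K n p -> y \in gpar K n q ->
  x * y = (-1) ^+ (p * q) *: (y * x).
Proof.
move=> xp yq; move: x xp; apply: gpar_ind => [|k u v IHu IHv|A <-].
- by rewrite mul0r mulr0 scaler0.
- by rewrite mulrDl mulrDr -scalerAl -scalerAr IHu IHv scalerDr !scalerA mulrC.
move: y yq; apply: gpar_ind => [|k u v IHu IHv|B <-].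
- by rewrite mul0r mulr0 scaler0.
- by rewrite mulrDl mulrDr -scalerAl -scalerAr IHu IHv scalerDr !scalerA mulrC.
by rewrite gmono_comm mulnb -oddM signr_odd.
Qed.

(** * The Leibniz rule for left derivatives *)

(** Recasts the sign in [gderiv] as an inversion count, so that additivity of [ginv] applies to
    it. *)
Lemma card_ltn_ginv A (c : 'I_n) :
  #|[set a in A | (a < c)%N]| = ginv [set c] A.
Proof.
rewrite /ginv big_set1 -sum1_card big_mkcond [RHS]big_mkcond /=.
by apply: eq_bigr => a _; rewrite inE; case: (a \in A); case: ltnP.
Qed.

Lemma gderiv_mono c A : gderiv c (gmono K A) =
  if c \in A then (-1) ^+ ginv [set c] A *: gmono K (A :\ c) else 0.
Proof.
rewrite /gderiv; case: ifP => cA; last first.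
  rewrite big1 // => B cB; rewrite gmonoE; case: eqP => [eAB|_].
    by rewrite eAB cB in cA.
  by rewrite mul0r scale0r.
rewrite (bigD1 A) //= big1 ?addr0 => [|B /andP[_ neB]].
  by rewrite gmonoE eqxx [X in X *: _]mul1r card_ltn_ginv.
by rewrite gmonoE eq_sym (negPf neB) [X in X *: _]mul0r scale0r.
Qed.

Lemma ggen_mono a A : ggen K a * gmono K A =
  if a \in A then 0 else (-1) ^+ ginv [set a] A *: gmono K (a |: A).
Proof.
by rewrite gmonoM /gmono_mul disjoints_subset sub1set inE; case: (a \in A).
Qed.

Lemma ginv1U1 (a c : 'I_n) A : a \notin A ->
  ginv [set c] (a |: A) = ((a < c) + ginv [set c] A)%N.
Proof.
move=> aA; rewrite ginvUr ?disjoints_subset ?sub1set ?inE //.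
by rewrite {1}/ginv !big_set1.
Qed.

(** The canonical anticommutation relation between derivatives and generators. It is checked on
    monomials, by cases on a = c and on which of a, c occur. *)
Lemma gderiv_ggenM c a y :
  gderiv c (ggen K a * y) = (a == c)%:R *: y - ggen K a * gderiv c y.
Proof.
move: y; apply: gmono_ind => [|k u v IHu IHv|A].
- by rewrite mulr0 !linear0 mulr0 subr0.
- rewrite mulrDr -scalerAr !linearP /= IHu IHv mulrDr -scalerAr.
  by rewrite !scalerDr !scalerA scalerN opprD [k * _]mulrC addrACA.
rewrite ggen_mono gderiv_mono; have [<-{c}|neac] := eqVneq a c.
  rewrite scale1r; case: ifP => aA.
    rewrite linear0 -scalerAr ggen_mono !inE eqxx /= setD1K // scalerA -exprD.
    rewrite -[in ginv _ A](setD1K aA) ginv1U1 ?inE ?eqxx // ltnn add0n.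
    by rewrite addnn -mul2n exprM sqrrN expr1n expr1n scale1r subrr.
  rewrite mulr0 subr0 linearZ_LR /= gderiv_mono setU11 setU1K ?aA //.
  rewrite ginv1U1 ?aA // ltnn add0n scalerA -exprD addnn -mul2n exprM.
  by rewrite sqrrN expr1n expr1n scale1r.
rewrite scale0r sub0r; case: ifP => aA; case: ifP => cA.
- by rewrite linear0 -scalerAr ggen_mono !inE neac aA scaler0 oppr0.
- by rewrite linear0 mulr0 oppr0.
- rewrite linearZ_LR /= gderiv_mono !inE cA orbT -scalerAr ggen_mono !inE neac.
  rewrite aA /= !scalerA -!exprD -scaleNr ginv1U1 ?aA //.
  have -> : (a |: A) :\ c = a |: (A :\ c).
    apply/setP => i; rewrite !inE; case: eqP => // ->.
    by rewrite eq_sym (negPf neac).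
  congr (_ *: _); rewrite -[in ginv [set a] A](setD1K cA) ginv1U1 ?inE ?eqxx //.
  (* Exactly one of a < c and c < a holds; this single inversion is the minus sign. *)
  have : (a != c :> nat) by [].
  case: ltngtP => // _ _; rewrite ?add0n ?add1n;
    by rewrite ?addnS ?addSn exprS mulN1r addnC.
rewrite mulr0 oppr0 linearZ_LR /= gderiv_mono !inE cA.
by rewrite eq_sym (negPf neac) scaler0.
Qed.

(** Induction on the size of A: splitting off one generator costs one sign, by [gderiv_ggenM]. *)
Lemma gderiv_monoM c A y : gderiv c (gmono K A * y) =
  gderiv c (gmono K A) * y + (-1) ^+ #|A| *: (gmono K A * gderiv c y).
Proof.
move: {2}#|A| (leqnn #|A|) => m; elim: m A y => [|m IHm] A y.
  rewrite leqn0 cards_eq0 => /eqP->; rewrite gderiv_mono inE cards0 scale1r.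
  by rewrite mul0r add0r !mul1r.
have [-> _|[a aA]] := set_0Vmem A.
  rewrite gderiv_mono inE cards0 scale1r.
  by rewrite mul0r add0r !mul1r.
rewrite (cardsD1 a A) aA ltnS => lem.
set s : K := (-1) ^+ ginv [set a] (A :\ a).
have -> : gmono K A = s *: (ggen K a * gmono K (A :\ a)).
  rewrite ggen_mono !inE eqxx /= setD1K // scalerA -expr2 sqrr_sign.
  by rewrite scale1r.
have dZ k x : gderiv c (k *: x) = k *: gderiv c x by exact: linearZ_LR.
rewrite -!scalerAl !dZ -!scalerAl [in RHS]scalerA [in RHS](mulrC _ s).
rewrite -scalerA -scalerDr; congr (_ *: _).
rewrite -!mulrA !gderiv_ggenM IHm //.
rewrite mulrBl mulrDr opprD.
by rewrite -scalerAl mulrA -addrA -scalerAr exprS mulN1r scaleNr.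
Qed.

Lemma gderivM c p x y : x \in gpar K n p ->
  gderiv c (x * y) = gderiv c x * y + (-1) ^+ p *: (x * gderiv c y).
Proof.
move=> xp; move: x xp; apply: gpar_ind => [|k u v IHu IHv|A <-].
- by rewrite linear0 !mul0r linear0 scaler0 addr0.
- rewrite mulrDl -scalerAl !linearP /= IHu IHv !mulrDl -!scalerAl.
  by rewrite !scalerDr !scalerA [k * _]mulrC addrACA.
by rewrite gderiv_monoM signr_odd.
Qed.

End GrassmannDerivations.

(** * Cocycles as functionals vanishing on the image of the differential *)

Section CyclicCocycles.
Variables (K : fieldType) (g : lieAlgebra K) (n : nat) (e : n.-tuple g).
Local Notation G := (grassmann K n).
Local Notation dCE := (dCE e).
Implicit Types (x y t : G) (tau : 'Hom(G, K^o)).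

(** The quadratic factor in front of each derivative is even and passes x freely, so the sign is
    that of the odd derivative alone. *)
Lemma dCEM p x y : x \in gpar K n p ->
  dCE (x * y) = dCE x * y + (-1) ^+ p *: (x * dCE y).
Proof.
move=> xp; rewrite /Defs.dCE -scalerAl -scalerAr scalerA [_ * 2^-1]mulrC.
rewrite -scalerA -scalerDr; congr (_ *: _).
do 3! (rewrite mulr_suml mulr_sumr scaler_sumr -big_split;
  apply: eq_bigr => ? _ /=).
rewrite -scalerAl -scalerAr scalerA [_ * structure_const _ _ _ _]mulrC.
rewrite -scalerA -scalerDr; congr (_ *: _).
rewrite (gderivM _ _ xp) mulrDr -scalerAr !mulrA; congr (_ + _ *: (_ * _)).
rewrite -mulrA (gmul_comm (gmul_par (ggen_par _ _) (ggen_par _ _)) xp).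
by rewrite addbb mul0n scale1r mulrA.
Qed.

Lemma star_hom p x y : x \in gpar K n p ->
  star e x y = (-1) ^+ p *: (dCE x * y).
Proof.
move=> xp; rewrite /star (bigD1 p) //= big1 ?addr0 ?(gproj_id xp) // => q nqp.
by rewrite (gproj_neq xp nqp) linear0 mul0r scaler0.
Qed.

(* Graded commutativity turns the two star products of the coboundary into   *)
(* the two terms of the Leibniz rule.                                        *)
Lemma cyclic_b_dCE tau p q x y : x \in gpar K n p -> y \in gpar K n q ->
  cyclic_b e tau x y = (-1) ^+ p * tau (dCE (x * y)).
Proof.
move=> xp yq; rewrite (cyclic_b_hom e tau xp yq).
rewrite (star_hom y xp) (star_hom x yq) (gmul_comm (dCE_par e yq) xp).
rewrite (dCEM y xp) !linearD !linearZ /= mulrDr.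
(* On the left, the minus sign times (-1)^((p+1)(q+1) + q + (q+1)p) is +1, as is (-1)^p (-1)^p on
   the right. *)
congr (_ + _); rewrite -(signr_odd _ (p.+1 * q.+1)) oddM mulnb.
case: p {xp yq}; case: q; rewrite /= ?expr0 ?expr1 ?(scaleN1r, scale1r).
all: by rewrite ?(mulN1r, mul1r) ?opprK.
Qed.

Lemma HC0_dCEP tau :
  reflect (forall x, tau (dCE x) = 0) (tau \in HC0 e).
Proof.
apply: (iffP (HC0P e tau)) => [t0 x | t0 x y]; last first.
  rewrite cyclic_b_split big1 // => p _; rewrite big1 // => q _.
  by rewrite (cyclic_b_dCE tau (gproj_par p x) (gproj_par q y)) t0 mulr0.
(* The constant function 1 serves as second argument: x 1 = x recovers the value of tau on d x for
   homogeneous x. *)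
have one_par : (1 : G) \in gpar K n false.
  by have := gmono_par K (set0 : {set 'I_n}); rewrite cards0.
have t0p p : tau (dCE (gproj p x)) = 0.
  have := cyclic_b_dCE tau (gproj_par p x) one_par; rewrite t0 mulr1.
  by move/esym/eqP; rewrite mulf_eq0 signr_eq0 => /eqP.
by rewrite (gproj_sum x) !linearD /= !t0p addr0.
Qed.

(** * Functionals as multivectors, cocycles as cycles *)

Definition cochain_mv tau : G := Grassmann [ffun A => tau (gmono K A) : K].

Lemma cochain_mv_linear : linear cochain_mv.
Proof.
move=> k s t; apply: grassmannP => A.
by rewrite gcoefD gcoefZ !ffunE add_lfunE scale_lfunE.
Qed.
HB.instance Definition _ :=
  GRing.isLinear.Build K 'Hom(G, K^o) G *:%R cochain_mv cochain_mv_linear.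

Lemma gpairing_cochain_mv tau x : gpairing (cochain_mv tau) x = tau x.
Proof.
rewrite [in RHS](gexpand x) linear_sum; apply: eq_bigr => A _.
by rewrite linearZ ffunE mulrC.
Qed.

Lemma cochain_mv_inj : injective cochain_mv.
Proof.
by move=> s t st; apply/lfunP => x; rewrite -!gpairing_cochain_mv st.
Qed.

Lemma cochain_mv_surj t : exists tau, cochain_mv tau = t.
Proof.
(* The pairing is repackaged as linear into the module [K^o], the codomain of cochains. *)
have pL : linear (gpairing t : G -> K^o).
  by move=> k u v; rewrite linearP.
pose HL := GRing.isLinear.Build K G K^o *:%R (gpairing t : G -> K^o) pL.
pose h : {linear G -> K^o} := HB.pack (gpairing t : G -> K^o) HL.
exists (linfun h); apply: grassmannP => A.
by rewrite ffunE lfunE /= gpairing_monor.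
Qed.

Lemma HC0_cycleE tau : (tau \in HC0 e) = (boundaryCE e (cochain_mv tau) == 0).
Proof.
apply/HC0_dCEP/eqP => [t0|b0 x].
  apply: grassmannP => A.
  by rewrite boundaryCE_coef gpairing_cochain_mv t0 gcoef0.
rewrite -gpairing_cochain_mv boundaryCE_adjoint b0.
by apply: big1 => A _; rewrite gcoef0 mul0r.
Qed.

Lemma cochain0_parE tau p :
  (tau \in cochain0_par K n p) = (cochain_mv tau \in gpar K n p).
Proof.
apply/cochain0_parP/gparP => [t0 A nA|t0 x /gparP xp].
  have oA : odd #|A| = ~~ p by move: nA; case: (odd _); case: (p).
  by rewrite ffunE t0 // -oA gmono_par.
rewrite -gpairing_cochain_mv; apply: big1 => A _.
have [Ap|/t0->] := eqVneq (odd #|A|) p; last by rewrite mul0r.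
by rewrite xp ?mulr0 // Ap; case: (p).
Qed.

(** Reduces membership in a sum of cycle groups to a single kernel condition, by splitting t into
    its homogeneous components [c k]. *)
Lemma cycles_parP p t :
  reflect (t \in gpar K n p /\ boundaryCE e t = 0) (t \in cycles_par e p).
Proof.
apply: (iffP idP) => [tZ|[/gparP tp bt0]].
  have /subvP/(_ t tZ) : (cycles_par e p <=
      gpar K n p :&: lker (linfun (boundaryCE e)))%VS.
    apply/subv_sumP => k /eqP<-; apply/subvP => s /cyclesP[sk bs0].
    by rewrite memv_cap gdeg_par //= memv_ker lfunE /= bs0.
  by rewrite memv_cap memv_ker lfunE => /andP[? /eqP].
pose c (k : 'I_n.+1) : G :=
  Grassmann [ffun A : {set 'I_n} => if #|A| == k then t A else 0].
have lt_card (A : {set 'I_n}) : (#|A| < n.+1)%N.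
  by rewrite ltnS -[n in leqRHS]card_ord max_card.
have -> : t = \sum_(k < n.+1 | odd k == p) c k.
  apply: grassmannP => A; rewrite gcoef_sum.
  have [Ap|nAp] := eqVneq (odd #|A|) p.
    rewrite (bigD1 (Ordinal (lt_card A))) ?Ap //= big1 ?addr0 => [|k /andP[_]].
      by rewrite ffunE eqxx.
    by rewrite -(inj_eq val_inj) ffunE eq_sym => /negPf->.
  rewrite (tp A nAp) big1 // => k /eqP kp; rewrite ffunE.
  by case: eqP => // Ak; rewrite Ak kp eqxx in nAp.
apply: memv_sumr => k kp; apply/cyclesP; split.
  by apply/gdegP => A /negPf nAk; rewrite ffunE nAk.
apply: grassmannP => A; rewrite boundaryCE_coef gcoef0.
have /gdegP dA := dCE_deg e (gmono_deg K A).
(* The boundary coefficient at A involves only coefficients of degree [#|A|.+1]. If that degree is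
   k, then [c k] has the same ones as t; otherwise they vanish. *)
have [Ak|nAk] := eqVneq #|A|.+1 k; last first.
  apply: big1 => B _; rewrite ffunE; case: eqP => [Bk|]; last by rewrite mul0r.
  by rewrite dA ?mulr0 // Bk eq_sym.
rewrite -[RHS](gcoef0 K A) -bt0 boundaryCE_coef; apply: eq_bigr => B _.
rewrite ffunE; case: eqP => // nBk; rewrite dA ?mulr0 //; apply/eqP.
by rewrite Ak.
Qed.

Lemma limg_HC0_par p : (linfun cochain_mv @: HC0_par e p)%VS = cycles_par e p.
Proof.
apply/vspaceP => t; apply/memv_imgP/cycles_parP => [[tau]|[tp bt0]].
  by rewrite memv_cap HC0_cycleE cochain0_parE lfunE => /andP[/eqP ? ?] ->.
have [tau ttau] := cochain_mv_surj t; exists tau; last by rewrite lfunE.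
by rewrite memv_cap HC0_cycleE cochain0_parE ttau bt0 eqxx.
Qed.

End CyclicCocycles.

(** An injective map of the ambient spaces that matches the graded parts restricts to an isomorphism
    of their sums. *)
Lemma sub_super_isomorphic (K : fieldType) (V V' : vectType K)
    (U : {vspace V}) (U' : {vspace V'})
    (W : bool -> {vspace V}) (W' : bool -> {vspace V'})
    (WU : (W false + W true)%VS = U) (W0 : (W false :&: W true)%VS = 0%VS)
    (WU' : (W' false + W' true)%VS = U')
    (W0' : (W' false :&: W' true)%VS = 0%VS) (f : 'Hom(V, V')) :
    lker f = 0%VS -> (forall p, (f @: W p)%VS = W' p) ->
  sv_isomorphic (sub_super WU W0) (sub_super WU' W0').
Proof.
move=> /eqP f_inj fW; have fU : (f @: U)%VS = U' by rewrite -WU limgD !fW.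
pose vsval' : 'Hom(subvs_of U, V) := linfun vsval.
(* The projection onto U' acts as the identity here, because f maps U onto U'. *)
pose h : 'Hom(subvs_of U, subvs_of U') :=
  (linfun (vsproj U') \o f \o vsval')%VF.
have hE u : vsval (h u) = f (vsval u).
  by rewrite !comp_lfunE !lfunE /= vsprojK // -fU memv_img ?subvsP.
have h_surj v : exists2 u, vsval u \in U & h u = v.
  have /memv_imgP[w Uw vw] : vsval v \in (f @: U)%VS by rewrite fU subvsP.
  by exists (vsproj U w); [exact: subvsP|apply: val_inj; rewrite /= hE vsprojK].
exists h; split.
  have h_inj : injective h.
    move=> u v huv; apply: val_inj; apply: (elimT lker0P f_inj).
    by rewrite /= -!hE huv.
  have hK u : (h^-1 (h u))%VF = u by apply/lker0_lfunK/lker0P.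
  by exists (h^-1)%VF => // v; have [u _ <-] := h_surj v; rewrite hK.
move=> p; apply/vspaceP => v; rewrite mem_sub_part -fW.
apply/memv_imgP/memv_imgP => [[u + ->]|[w Ww vw]].
  by rewrite mem_sub_part => Wu; exists (vsval u); rewrite ?hE.
have Uw : w \in U.
  by apply: subvP Ww; rewrite -WU; case: p; [exact: addvSr|exact: addvSl].
exists (vsproj U w); first by rewrite mem_sub_part vsprojK.
by apply: val_inj; rewrite /= hE vsprojK.
Qed.

Theorem proposition3p7 (R : realType) (g : lieAlgebra R) (n : nat)
    (hdim : \dim (fullv : {vspace g}) = n)
    (e : n.-tuple g) (he : basis_of fullv e) :
  sv_isomorphic (HC0_super e) (cycles_super e).
Proof.
apply: (sub_super_isomorphic _ _ _ _ _ (limg_HC0_par e)).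
apply/eqP/lker0P => s t; rewrite !lfunE; exact: cochain_mv_inj.
Qed.
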